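(* Let $\mathbb K$ be a field of characteristic $0$ and let $x\in\mathbb K$. Let $D_1$ and $D_2$ be two nonempty dissection diagrams. Then $L(D_1)=L(D_2)$ if and only if $D_1=D_2$.
   Context: Dissection diagrams. For $n\ge 0$ let $\Pi_n$ be the regular $(n+1)$-gon with vertices $0,1,\dots,n$ numbered clockwise; vertex $0$ is the root. For $0\le i\le n$, side $i$ goes from vertex $i$ to vertex $i+1$ (with $n+1$ read as $0$). A chord is a segment joining two distinct vertices (adjacent vertices are allowed; such a chord is distinct from the side). A dissection diagram of degree $n$ is a set of $n$ pairwise non-crossing chords (they may share endpoints) of $\Pi_n$ forming an acyclic graph, hence a spanning tree on $\{0,\dots,n\}$. It is nonempty if $n\ge1$. All chords are oriented towards the root. $\mathrm{Ch}(D)$ is the set of chords of $D$. The diagram of degree $0$ is identified with $1$; $a$ denotes the diagram of degree $1$. Coproduct. $\mathcal H_D$ is the commutative polynomial algebra on dissection diagrams of positive degree, with $\Delta(D)=\sum_{C\subset \mathrm{Ch}(D)}x^{k_C(D)}q_C(D)\otimes r_C(D)$ (with $x^0=1$). Here the $p=|C|$ chords of $C$ cut the polygon into $p+1$ faces; for a face $\alpha$ let $S_C(\alpha)$ be the (nonempty) set of sides of the polygon bordering $\alpha$. $q_C(D)$ is obtained by contracting every chord of $C$ to a point: each face $\alpha$ becomes a polygon with set of sides $S_C(\alpha)$, rooted at the starting vertex of its side of minimal label, carrying the chords of $D$ not in $C$ that lie in $\alpha$; this is a dissection diagram, and $q_C(D)$ is the product of these over all faces. $r_C(D)$ is the dissection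 diagram of degree $p$ obtained by keeping the chords of $C$ and contracting all sides which are not the minimal side of their face, the root being the image of $0$. $k_C(D)$ is the number of chords of $C$ whose orientation in $D$ is opposite to their orientation (towards the root) in $r_C(D)$. The map $L$. For a nonempty dissection diagram $D$, $L(D)=\sum_G c(D,a;G)\,G$, sum over dissection diagrams $G$, where $c(D,a;G)$ is the coefficient of $D\otimes a$ in $\Delta(G)$; it is an element of the vector space with basis the nonempty dissection diagrams. *)

(* Defs.v *)
(* MathComp, with monomials and free modules from multinomials. *)
From HB Require Import structures.
From mathcomp Require Import all_boot all_order all_algebra.
From mathcomp Require Import zify finmap.
From mathcomp.multinomials Require Import monalg.

Set Implicit Arguments.
Unset Strict Implicit.
Unset Printing Implicit Defensive.

Import GRing.Theory.

(* The vertices and the sides of the (n+1)-gon are both indexed by 'I_n.+1: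
   side i joins vertex i to vertex i+1, and side n joins vertex n to the root
   ord0. A chord is encoded by the pair of its endpoints, the smaller one
   first. *)
Definition chord n := ('I_n.+1 * 'I_n.+1)%type.

Section Configurations.
Context {n : nat}.
Implicit Types (c d : chord n) (E C : {set chord n})
  (u v s t : 'I_n.+1) (alpha S : {set 'I_n.+1}).

Definition crossing c d : bool :=
  (c.1 < d.1 < c.2) && (c.2 < d.2) || (d.1 < c.1 < d.2) && (d.2 < c.2).

Definition adj E : rel 'I_n.+1 := fun u v => ((u, v) \in E) || ((v, u) \in E).

(* The bound on k is harmless, a duplicate-free sequence of vertices having
   length at most n.+1. *)
Definition acyclic E : bool :=
  [forall k : 'I_n.+2, forall p : k.-tuple 'I_n.+1,
     (2 < k) ==> ~~ ucycleb (adj E) p].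

Definition dissection E : bool :=
  [&& [forall c in E, c.1 < c.2],
      [forall c in E, forall d in E, ~~ crossing c d],
      acyclic E & #|E| == n].

(* A chord cuts the polygon into the part bordered by the sides c.1, ...,
   c.2 - 1, and the part bordered by the other sides, among which side n. *)
Definition under c s : bool := c.1 <= s < c.2.

(* For d <> c not crossing c, whether d is in the part bordered by c.1, ...,
   c.2 - 1. *)
Definition under_chord c d : bool := (c.1 <= d.1) && (d.2 <= c.2).

(* Two sides border the same face if no chord of C separates them; each face
   is represented by its (nonempty) set of sides. *)
Definition same_face C s t : bool := [forall c in C, under c s == under c t].

Definition faces C : {set {set 'I_n.+1}} :=
  equivalence_partition (same_face C) [set: 'I_n.+1].

Definition in_face C alpha d : bool :=
  [forall c in C, forall s in alpha, under_chord c d == under c s].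

Definition minimal_sides C : {set 'I_n.+1} :=
  [set s | [forall t, same_face C s t ==> (s <= t)]].

(* The image of a vertex in the polygon with m.+1 = #|S| sides obtained by
   contracting everything but the sides in S, the new sides being numbered in
   the order of their labels: going clockwise from v, the first side of S is
   the one with index #|[set s in S | s < v]|, or 0 if this is m.+1. *)
Definition collapse m S v : 'I_m.+1 :=
  inord (#|[set s in S | s < v]| %% m.+1).

Definition collapse_chord m S c : chord m :=
  let u := collapse m S c.1 in let v := collapse m S c.2 in
  if u < v then (u, v) else (v, u).

Definition face_chords E C alpha : {set chord #|alpha|.-1} :=
  [set collapse_chord #|alpha|.-1 alpha d | d in [set d in E :\: C | in_face C alpha d]].

Definition residual_chords C : {set chord #|C|} :=
  [set collapse_chord #|C| (minimal_sides C) c | c in C].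

(* The chord {u, v}, oriented towards the root, goes from u to v. *)
Definition arrow E u v : bool :=
  adj E u v && connect (adj (E :\: [set (u, v); (v, u)])) v ord0.

End Configurations.

Section Theory.
Context {n : nat}.
Implicit Types (c d : chord n) (E C : {set chord n}) (u v s t : 'I_n.+1).

Definition ordered E := forall c, c \in E -> c.1 < c.2.
Definition noncrossing E := forall c d, c \in E -> d \in E -> ~~ crossing c d.

Lemma dissectionP E :
  reflect [/\ ordered E, noncrossing E, acyclic E & #|E| = n] (dissection E).
Proof.
apply: (iffP and4P) => [[/forall_inP o /forall_inP x a /eqP k]|[o x a k]].
  by split=> // c d cE dE; have /forall_inP := x c cE; apply.
split=> //; last exact/eqP.
  exact/forall_inP.
by apply/forall_inP => c cE; apply/forall_inP => d dE; apply: x.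
Qed.

Lemma same_faceP E s t :
  reflect (forall c, c \in E -> under c s = under c t) (same_face E s t).
Proof. by apply: (iffP forall_inP) => h c /h /eqP. Qed.

Lemma same_face_refl E s : same_face E s s.
Proof. exact/same_faceP. Qed.

Lemma same_face_sym E s t : same_face E s t = same_face E t s.
Proof. by apply/same_faceP/same_faceP => h c /h. Qed.

Lemma same_face_trans E : transitive (same_face E).
Proof.
by move=> t s r /same_faceP h /same_faceP k; apply/same_faceP => c cE; rewrite h ?k.
Qed.

Lemma same_face_equiv E : {in [set: 'I_n.+1] & &, equivalence_rel (same_face E)}.
Proof.
move=> s t r _ _ _; split; first exact: same_face_refl.
move=> h; apply/idP/idP; last exact: same_face_trans.
by apply: same_face_trans; rewrite same_face_sym.
Qed.

Lemma adj_sym E : symmetric (adj E).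
Proof. by move=> u v; rewrite /adj orbC. Qed.

(* The pair of sides s <= t is separated by a chord iff exactly one of its
   endpoints lies on the arc from s to t. *)
Lemma under_arc c s t : c.1 < c.2 -> s <= t ->
  (under c s == under c t) = ((s < c.1 <= t) == (s < c.2 <= t)).
Proof. by rewrite /under => *; apply/eqP/eqP; lia. Qed.

Lemma connect_arc E s t u v : ordered E -> same_face E s t -> s <= t ->
  connect (adj E) u v -> (s < u <= t) = (s < v <= t).
Proof.
move=> oE /same_faceP h st uv.
have cl : closed (adj E) [pred w : 'I_n.+1 | s < w <= t].
  move=> a b /orP[] H; have /= := under_arc (oE _ H) st; rewrite h // eqxx;
    by move=> /esym /eqP; rewrite !inE.
exact: (closed_connect cl uv).
Qed.

Lemma same_faceD1 E c : ordered E -> c \in E ->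
  connect (adj (E :\ c)) c.1 c.2 -> forall s t,
  same_face (E :\ c) s t = same_face E s t.
Proof.
move=> oE cE con s t; apply/idP/idP; last first.
  by move=> /same_faceP h; apply/same_faceP => d /setD1P[_ /h].
wlog st : s t / s <= t => [W h|h].
  case: (leqP s t) => [|/ltnW] st; first exact: W.
  by rewrite same_face_sym; apply: W; rewrite // same_face_sym.
have oE' : ordered (E :\ c) by move=> d /setD1P[_ /oE].
have /eqP := connect_arc oE' h st con.
rewrite -under_arc ?oE // => /eqP k.
apply/same_faceP => d dE; have [->//|dc] := eqVneq d c.
by move/same_faceP: h; apply; rewrite !inE dc.
Qed.


Lemma connect_adj_sym E : connect_sym (adj E).
Proof. exact: sym_connect_sym (adj_sym E). Qed.

Lemma acyclic_bridge E c : ordered E -> acyclic E -> c \in E ->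
  ~~ connect (adj (E :\ c)) c.1 c.2.
Proof.
move=> oE ac cE; apply/negP => /connectP[p0].
case/shortenP => p P U _ lastp.
have lt12 := oE _ cE.
have sz : size (c.1 :: p) < n.+2 by rewrite ltnS; have := max_card (mem (c.1 :: p)); rewrite card_ord (card_uniqP U).
have /forallP /(_ (Ordinal sz)) /forallP /(_ (in_tuple (c.1 :: p))) := ac.
have -> /= : 2 < (size p).+1.
  case: p P lastp {U sz} => [_ /= e|a [|b p]] //=.
    by move: lt12; rewrite e ltnn.
  rewrite andbT => H e; move: H; rewrite -e /adj !inE -surjective_pairing eqxx /=.
  by case/andP=> _ /oE /=; rewrite ltnNge ltnW.
rewrite /ucycleb U andbT /= rcons_path -lastp => /negP; apply; apply/andP; split.
  by apply: sub_path P => u v; rewrite /adj !inE => /orP[]/andP[_ ->]; rewrite ?orbT.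
by rewrite /adj -surjective_pairing cE orbT.
Qed.

Lemma bridge_acyclic E :
  (forall c, c \in E -> ~~ connect (adj (E :\ c)) c.1 c.2) -> acyclic E.
Proof.
move=> br.
have {}br u v c : c = (u, v) \/ c = (v, u) -> c \in E ->
    ~~ connect (adj (E :\ c)) v u.
  by case=> -> /br //=; rewrite connect_adj_sym.
apply/forallP => k; apply/forallP => -[p /= sp]; apply/implyP; rewrite -(eqP sp).
case: p {sp} => [|x [|y [|z p]]] //= _.
apply/negP => /andP[/= /and3P[xy yz P]].
rewrite !inE !negb_or => /andP[/and3P[nxy nxz nxp] /andP[/andP[nyz nyp] _]].
have key c : c = (x, y) \/ c = (y, x) -> connect (adj (E :\ c)) y x.
  move=> cxy.
  have ne a b : b != x -> b != y -> (a, b) != c /\ (b, a) != c.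
    by move=> bx by_; case: cxy => ->; rewrite !xpair_eqE (negPf bx) (negPf by_) ?andbF.
  have ne' a b : a != y -> b != y -> (a, b) != c.
    by move=> ay by_; case: cxy => ->; rewrite !xpair_eqE ?(negPf ay) ?(negPf by_) ?andbF.
  have yz' : adj (E :\ c) y z.
    have [zx zy] : z != x /\ z != y by rewrite eq_sym nxz eq_sym nyz.
    by have [h1 h2] := ne y z zx zy; rewrite /adj !inE h1 h2.
  apply: (connect_trans (connect1 yz')).
  apply/connectP; exists (rcons p x); last by rewrite last_rcons.
  have : y \notin z :: rcons p x by rewrite inE mem_rcons inE !negb_or nyz (eq_sym y) nxy nyp.
  elim: (rcons p x) z P {yz nxz nyz yz'} => //= b q IH a /andP[ab Q].
  rewrite !inE !negb_or ![y == _]eq_sym => /and3P[ya yb yq].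
  rewrite /adj !inE !ne' //= -/(adj E a b) ab IH //.
  by rewrite inE negb_or eq_sym yb.
case/orP: (xy) => H.
  by have := br x y (x, y) (or_introl erefl) H; rewrite key //; left.
by have := br x y (y, x) (or_intror erefl) H; rewrite key //; right.
Qed.

Fact under_last c : under c ord_max = false.
Proof. by rewrite /under /=; have := ltn_ord c.2; lia. Qed.

(* The innermost chord above a side. *)
Definition innermost_pred E s c : bool :=
  (c \in E) && under c s &&
    [forall d in E, under d s ==> under_chord d c].
Definition innermost E s : option (chord n) := [pick c | innermost_pred E s c].

Lemma innermost_ex E s c : ordered E -> noncrossing E -> c \in E -> under c s ->
  exists d, innermost_pred E s d.
Proof.
move=> oE xE cE cs.
have Pc : (c \in E) && under c s by rewrite cE.
case: (@arg_minnP _ c (fun d => (d \in E) && under d s) (fun d => d.2 - d.1) Pc) => d /andP[dE ds] dmin.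
exists d; rewrite /innermost_pred dE ds /=; apply/forall_inP => e eE; apply/implyP => es.
have := dmin e; rewrite eE es => /(_ isT).
have := xE _ _ dE eE; have := oE _ dE; have := oE _ eE.
move: ds es; rewrite /under /under_chord /crossing; lia.
Qed.

Lemma innermost_uniq E s c d : innermost_pred E s c -> innermost_pred E s d -> c = d.
Proof.
move=> /=/andP[/andP[cE cs] /forall_inP hc] /andP[/andP[dE ds] /forall_inP hd].
have := hc d dE; have := hd c cE; rewrite cs ds /under_chord /= => h1 h2.
case: c d {cE cs hc dE ds hd} h1 h2 => [c1 c2] [d1 d2] /= h1 h2.
by congr pair; apply: val_inj => /=; lia.
Qed.

Lemma innermostP E s c : innermost_pred E s c -> innermost E s = Some c.
Proof.
rewrite /innermost; case: pickP => [d hd|/(_ c) ->//] hc.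
by rewrite (innermost_uniq hc hd).
Qed.

Lemma innermost_same E s t : ordered E -> noncrossing E ->
  (innermost E s == innermost E t) = same_face E s t.
Proof.
move=> oE xE; apply/eqP/same_faceP => [h c cE|h]; last first.
  apply: eq_pick => c; rewrite /innermost_pred -!(andbA (c \in E)).
  have [cE|//] /= := boolP (c \in E); rewrite h //; congr (_ && _).
  by apply: eq_forallb => d; have [dE|//] /= := boolP (d \in E); rewrite h.
suff key r w : innermost E r = innermost E w -> under c r -> under c w.
  by apply/idP/idP; apply: key.
move=> {}h cr; have [d hd] := innermost_ex oE xE cE cr.
move: h; rewrite (innermostP hd) /innermost; case: pickP => // e /= he [de].
move: he; rewrite -de => /andP[/andP[dE dw] _].
move: hd => /andP[_ /forall_inP /(_ c cE)]; rewrite cr /=.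
by move: dw; rewrite /under /under_chord; lia.
Qed.

Lemma minimal_inj E s t : s \in minimal_sides E -> t \in minimal_sides E ->
  same_face E s t -> s = t.
Proof.
rewrite !inE => /forallP /(_ t) /implyP h /forallP /(_ s) /implyP k st.
by apply/val_inj/eqP; rewrite eqn_leq h // k // same_face_sym.
Qed.

Lemma minimal_ex E s : exists2 t, t \in minimal_sides E & same_face E s t.
Proof.
case: (@arg_minnP _ s (same_face E s) val (same_face_refl E s)) => t st tmin.
exists t => //; rewrite inE; apply/forallP => r; apply/implyP => tr.
by apply: tmin; apply: same_face_trans tr.
Qed.

Lemma card_minimal_le E : ordered E -> noncrossing E -> #|minimal_sides E| <= #|E|.+1.
Proof.
move=> oE xE.
have inj : {in minimal_sides E &, injective (innermost E)}.
  by move=> s t sm tm /eqP; rewrite innermost_same //; apply: minimal_inj.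
rewrite -(card_in_imset inj).
have -> : #|E|.+1 = #|None |: [set Some c | c in E]|.
  rewrite cardsU1 card_imset; last by move=> ? ? [].
  by case: imsetP => // -[].
apply/subset_leq_card/subsetP => o /imsetP[s _ ->].
rewrite /innermost; case: pickP => [c /=/andP[/andP[cE _] _]|_]; rewrite !inE //.
by rewrite imset_f.
Qed.

Lemma bridge_innermost E c : ordered E -> noncrossing E -> c \in E ->
  ~~ connect (adj (E :\ c)) c.1 c.2 -> exists s, innermost_pred E s c.
Proof.
move=> oE xE cE br; have c12 := oE _ cE.
pose K := [pred v : 'I_n.+1 | (v < c.2) && (c.1 <= v) && connect (adj (E :\ c)) c.1 v].
have K0 : K c.1 by rewrite /= c12 leqnn connect0.
case: (@arg_maxnP _ c.1 K val K0) => v /= /andP[/andP[v2 v1] cv] vmax.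
have {}vmax (b : 'I_n.+1) : v < b <= c.2 -> ~~ connect (adj (E :\ c)) c.1 b.
  move=> /andP[vb b2]; apply/negP => cb.
  have [e|ne] := eqVneq b c.2; first by rewrite -e cb in br.
  by move: ne; have := vmax b; rewrite cb andbT -val_eqE /=; lia.
suff key d : d \in E -> under d v -> under_chord d c.
  exists v; rewrite /innermost_pred cE /under v1 v2 /=.
  by apply/forall_inP => d dE; apply/implyP; apply: key.
move=> dE /andP[d1v vd2].
have [->|dc] := eqVneq d c; first by rewrite /under_chord !leqnn.
have dE' : d \in E :\ c by rewrite !inE dc.
have ad : adj (E :\ c) d.1 d.2 by rewrite /adj -surjective_pairing dE'.
rewrite /under_chord; apply: contraT => nud.
have /andP[c1d d2c] : under_chord c d.
  move: (xE _ _ cE dE) nud c12 v2 v1 d1v vd2; rewrite /under_chord /crossing.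
  by clear; lia.
have nd2 : ~~ connect (adj (E :\ c)) c.1 d.2 by apply: vmax; rewrite vd2.
have nd1 : ~~ connect (adj (E :\ c)) c.1 d.1.
  by apply: contra nd2 => h; apply: connect_trans h (connect1 ad).
(* the vertices strictly inside d reachable from v stay strictly inside d *)
have cl : closed (adj (E :\ c))
    [pred w : 'I_n.+1 | (d.1 < w < d.2) && connect (adj (E :\ c)) c.1 w].
  apply: (intro_closed (connect_adj_sym _)) => a b ab; rewrite !inE => /andP[dad ca].
  have cb := connect_trans ca (connect1 ab); rewrite cb andbT.
  have nb1 : b != d.1 by apply: contraNneq nd1 => <-.
  have nb2 : b != d.2 by apply: contraNneq nd2 => <-.
  have {}nb1 : (b : nat) <> d.1 by move=> e; case/eqP: nb1; apply: val_inj.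
  have {}nb2 : (b : nat) <> d.2 by move=> e; case/eqP: nb2; apply: val_inj.
  move: ab; rewrite /adj !inE => /orP[]/andP[_] abE;
    have /= lt_ab := oE _ abE; move: (xE _ _ dE abE) lt_ab dad nb1 nb2;
    rewrite /crossing /=; clear; lia.
have nv1 : v != d.1 by apply: contraNneq nd1 => <-.
have := closed_connect cl cv; rewrite !inE connect0 cv !andbT.
by move: nv1 d1v vd2 c1d; rewrite -val_eqE /=; clear; lia.
Qed.

Lemma card_minimal E : ordered E -> noncrossing E -> acyclic E ->
  #|minimal_sides E| = #|E|.+1.
Proof.
move=> oE xE aE; apply/eqP; rewrite eqn_leq card_minimal_le //=.
have -> : #|E|.+1 = #|None |: [set Some c | c in E]|.
  rewrite cardsU1 card_imset; last by move=> ? ? [].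
  by case: imsetP => // -[].
apply: leq_trans (leq_imset_card (innermost E) _).
apply/subset_leq_card/subsetP => o oin.
have [s ->] : exists s, o = innermost E s.
  move: oin; rewrite !inE => /orP[/eqP ->|/imsetP[c cE ->]].
    exists ord_max; rewrite /innermost; case: pickP => // c.
    by rewrite /innermost_pred under_last andbF.
  have [s hs] := bridge_innermost oE xE cE (acyclic_bridge oE aE cE).
  by exists s; rewrite (innermostP hs).
have [t tm st] := minimal_ex E s.
by apply/imsetP; exists t => //; apply/eqP; rewrite innermost_same.
Qed.

Lemma minimal_full E : (forall s t, same_face E s t -> s = t) ->
  #|minimal_sides E| = n.+1.
Proof.
move=> sepE; rewrite (_ : minimal_sides E = setT) ?cardsT ?card_ord //.
by apply/setP => s; rewrite !inE; apply/forallP => t; apply/implyP => /sepE ->.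
Qed.

Lemma separated E : dissection E -> forall s t, same_face E s t -> s = t.
Proof.
case/dissectionP => oE xE aE kE s t; have := card_minimal oE xE aE.
rewrite kE => full; have/eqP fullE : minimal_sides E == setT.
  by rewrite eqEcard subsetT cardsT card_ord full /=.
by apply: minimal_inj; rewrite fullE inE.
Qed.

Lemma crossingP c d : c.1 < c.2 -> d.1 < d.2 ->
  reflect (forall a b, exists s, under c s = a /\ under d s = b) (crossing c d).
Proof.
move=> lc ld; have lst e := under_last e.
apply: (iffP idP) => [X [] []|H].
- by case/orP: X => X; [exists d.1|exists c.1]; rewrite /under; lia.
- by case/orP: X => X; [exists c.1|exists d.2]; rewrite /under; lia.
- by case/orP: X => X; [exists c.2|exists d.1]; rewrite /under; lia.
- by exists ord_max; rewrite !lst.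
have [s] := H true true; have [t] := H true false; have [r] := H false true.
by rewrite /under /crossing; lia.
Qed.

Lemma dissection_separated E : ordered E -> noncrossing E -> #|E| <= n ->
  (forall s t, same_face E s t -> s = t) -> dissection E.
Proof.
move=> oE xE kE sep.
apply/dissectionP; split=> //; last first.
  by apply/eqP; rewrite eqn_leq kE; have := card_minimal_le oE xE; rewrite minimal_full.
apply: bridge_acyclic => c cE; apply/negP => con.
have oE' : ordered (E :\ c) by move=> d /setD1P[_ /oE].
have xE' : noncrossing (E :\ c) by move=> d e /setD1P[_ dE] /setD1P[_ eE]; exact: xE.
have := card_minimal_le oE' xE'; rewrite minimal_full; last first.
  by move=> s t; rewrite same_faceD1 //; apply: sep.
by move: kE; rewrite (cardsD1 c E) cE ltnS => /leq_trans h /h; rewrite ltnn.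
Qed.

Lemma acyclic_sub E C : ordered E -> acyclic E -> C \subset E -> acyclic C.
Proof.
move=> oE aE /subsetP sCE; apply: bridge_acyclic => c cC.
apply: contra (acyclic_bridge oE aE (sCE _ cC)); apply: connect_sub => u v h.
by apply: connect1; move: h; rewrite /adj !inE => /orP[]/andP[-> /sCE ->]; rewrite ?orbT.
Qed.

End Theory.

Section Closure.
Context {n : nat}.
Implicit Types (c d : chord n) (E C : {set chord n}) (u v s t : 'I_n.+1).

Section Contraction.
Context {m : nat} (S : {set 'I_n.+1}).
Hypothesis cardS : #|S| = m.+1.

Let rank v := #|[set s in S | s < v]|.

Lemma rank_le v : rank v <= m.+1.
Proof. by rewrite -cardS; apply/subset_leq_card/subsetP => s; rewrite inE => /andP[]. Qed.

Lemma rank_lt s v : s \in S -> (rank s < rank v) = (s < v).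
Proof.
move=> sS; case: (ltnP s v) => sv.
  apply/proper_card/properP; split.
    by apply/subsetP => t; rewrite !inE => /andP[-> /= /ltn_trans]; apply.
  by exists s; rewrite !inE sS // ltnn.
apply/negbTE; rewrite -leqNgt; apply/subset_leq_card/subsetP => t.
by rewrite !inE => /andP[-> /= /leq_trans]; apply.
Qed.

Lemma rank_bound s : s \in S -> rank s < m.+1.
Proof.
move=> sS; rewrite -cardS; apply/proper_card/properP; split.
  by apply/subsetP => t; rewrite inE => /andP[].
by exists s; rewrite // inE ltnn andbF.
Qed.

Lemma collapseE v : collapse m S v = (if rank v == m.+1 then 0 else rank v) :> nat.
Proof.
rewrite /collapse inordK ?ltn_mod // -/(rank v).
case: eqP => [->|/eqP ne]; first by rewrite modnn.
by rewrite modn_small // ltn_neqAle ne rank_le.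
Qed.

Lemma collapse_side s : s \in S -> collapse m S s = rank s :> nat.
Proof. by move=> /rank_bound h; rewrite collapseE ltn_eqF. Qed.

Lemma collapse_onto (k : 'I_m.+1) : exists2 s, s \in S & collapse m S s = k.
Proof.
have inj : {in S &, injective (collapse m S)}.
  move=> s t sS tS /(congr1 val) /=; rewrite !collapse_side // => e.
  apply/val_inj => /=; move: (rank_lt s tS) (rank_lt t sS); rewrite e ltnn.
  by case: ltngtP.
have/eqP img : collapse m S @: S == setT.
  by rewrite eqEcard subsetT cardsT card_ord card_in_imset // cardS /=.
by have := in_setT k; rewrite -img => /imsetP[s sS ->]; exists s.
Qed.

Lemma under_collapse c : c.1 < c.2 -> exists b, forall s, s \in S ->
  under (collapse_chord m S c) (collapse m S s) = b (+) under c s.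
Proof.
move=> lc; exists ((rank c.1 <= m) && (m < rank c.2)) => s sS.
have := rank_bound sS; have := rank_lt c.1 sS; have := rank_lt c.2 sS.
have := rank_le c.1; have := rank_le c.2.
have rle : rank c.1 <= rank c.2.
  apply/subset_leq_card/subsetP => t.
  by rewrite !inE => /andP[-> /= /ltn_trans]; apply.
rewrite /under /collapse_chord; case: ifP => /=; rewrite !collapseE;
  move: (rank c.1) (rank c.2) (rank s) rle => a b r; clear;
  by case: eqP; case: eqP; case: eqP; lia.
Qed.

Lemma collapse_dissection E : ordered E -> noncrossing E ->
    {in S &, forall s t, same_face E s t -> s = t} ->
  m <= #|E| /\ (#|E| <= m -> dissection [set collapse_chord m S c | c in E]).
Proof.
move=> oE xE sep.
pose F := [set c in E | [exists s in S, exists t in S, under c s != under c t]].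
have sFE : F \subset E by apply/subsetP => c; rewrite inE => /andP[].
pose G : {set chord m} := [set collapse_chord m S c | c in F].
have oG : {in F, forall c, (collapse_chord m S c).1 < (collapse_chord m S c).2}.
  move=> c; rewrite inE => /andP[cE /exists_inP[s sS /exists_inP[t tS]]].
  have [b hb] := under_collapse (oE _ cE).
  have := hb _ sS; have := hb _ tS.
  case: (under c s) (under c t) => -[] //; rewrite ?addbT ?addbF /under; case: b {hb}; lia.
have oG' : ordered G by move=> _ /imsetP[c cF ->]; apply: oG.
have xG : noncrossing G.
  move=> _ _ /imsetP[c cF ->] /imsetP[d dF ->].
  have cE := subsetP sFE _ cF; have dE := subsetP sFE _ dF.
  apply: contra (xE _ _ cE dE) => /crossingP H.
  apply/(crossingP (oE _ cE) (oE _ dE)) => a b.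
  have [a' ha] := under_collapse (oE _ cE); have [b' hb] := under_collapse (oE _ dE).
  have [k [ka kb]] := H (oG _ cF) (oG _ dF) (a' (+) a) (b' (+) b).
  have [s sS sk] := collapse_onto k; exists s.
  move: ka kb; rewrite -sk ha // hb // => /addbI -> /addbI ->; by [].
have sepG (s t : 'I_m.+1) : same_face G s t -> s = t.
  have [s' sS <-] := collapse_onto s; have [t' tS <-] := collapse_onto t.
  move=> /same_faceP h; congr collapse; apply: sep => //; apply/same_faceP => c cE.
  apply: contraTeq isT => ne.
  have cF : c \in F.
    by rewrite inE cE; apply/exists_inP; exists s' => //; apply/exists_inP; exists t'.
  have [b hb] := under_collapse (oE _ cE).
  have := h _ (imset_f _ cF); rewrite !hb // => /addbI e.
  by rewrite e eqxx in ne.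
have mG : m <= #|G| by have := card_minimal_le oG' xG; rewrite minimal_full.
have mF : m <= #|F| by apply: leq_trans mG (leq_imset_card _ _).
split; first exact: leq_trans mF (subset_leq_card sFE).
move=> Em; have/eqP <- : F == E by rewrite eqEcard sFE (leq_trans Em).
apply: dissection_separated => //; apply: leq_trans (leq_imset_card _ _) _.
exact: leq_trans (subset_leq_card sFE) Em.
Qed.
End Contraction.

Lemma residual_dissection E C : dissection E -> C \subset E ->
  dissection (residual_chords C).
Proof.
case/dissectionP => oE xE aE _ sCE.
have oC : ordered C by move=> c /(subsetP sCE) /oE.
have xC : noncrossing C by move=> c d /(subsetP sCE) cE /(subsetP sCE); exact: xE.
have aC := acyclic_sub oE aE sCE.
have [|_] := collapse_dissection (card_minimal oC xC aC) oC xC; last exact.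
by move=> s t; apply: minimal_inj.
Qed.

Lemma facesP C alpha : reflect (exists s, alpha = [set t | same_face C s t])
  (alpha \in faces C).
Proof.
apply: (iffP imsetP) => [[s _ ->]|[s ->]]; exists s => //;
  by apply/setP => t; rewrite !inE.
Qed.

Lemma face_partition C : partition (faces C) [set: 'I_n.+1].
Proof. exact/equivalence_partitionP/same_face_equiv. Qed.

Lemma face_card C alpha : alpha \in faces C -> #|alpha| = #|alpha|.-1.+1.
Proof.
case/facesP => s ->; rewrite prednK //; apply/card_gt0P; exists s.
by rewrite inE same_face_refl.
Qed.

Lemma face_same C alpha : alpha \in faces C -> {in alpha &, forall s t, same_face C s t}.
Proof.
case/facesP => r -> s t; rewrite !inE => rs rt.
by apply: same_face_trans rt; rewrite same_face_sym.
Qed.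

Lemma face_uniq C alpha beta s t : alpha \in faces C -> beta \in faces C ->
  s \in alpha -> t \in beta -> same_face C s t -> alpha = beta.
Proof.
case/facesP => a -> /facesP[b ->]; rewrite !inE => as_ bt st.
have ab : same_face C a b.
  by rewrite (same_face_trans as_) // (same_face_trans st) // same_face_sym.
apply/setP => r; rewrite !inE; apply/idP/idP; last exact: same_face_trans.
by apply: same_face_trans; rewrite same_face_sym.
Qed.

Lemma card_faces C : #|faces C| = #|minimal_sides C|.
Proof.
pose f s := [set t | same_face C s t].
have inj : {in minimal_sides C &, injective f}.
  move=> s t sm tm /setP /(_ t); rewrite !inE same_face_refl; exact: minimal_inj.
rewrite -(card_in_imset inj); congr #|pred_of_set _|; apply/setP => alpha.
apply/facesP/imsetP => [[s ->]|[s _ ->]]; last by exists s.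
have [t tm st] := minimal_ex C s; exists t => //.
apply/setP => r; rewrite !inE; apply/idP/idP; last exact: same_face_trans.
by apply: same_face_trans; rewrite same_face_sym.
Qed.

Lemma sum_face_degrees C : ordered C -> noncrossing C -> acyclic C ->
  #|C| + \sum_(alpha in faces C) #|alpha|.-1 = n.
Proof.
move=> oC xC aC; apply/eqP; rewrite -eqSS -addSn -(card_minimal oC xC aC).
rewrite -card_faces -sum1_card -big_split /=.
apply/eqP; transitivity #|[set: 'I_n.+1]|; last by rewrite cardsT card_ord.
rewrite (card_partition (face_partition C)).
by apply: eq_bigr => alpha /face_card ->; rewrite add1n.
Qed.

Lemma face_dissection E C alpha : dissection E -> C \subset E ->
  alpha \in faces C -> dissection (face_chords E C alpha).
Proof.
move=> dE sCE; have [oE xE aE kE] := dissectionP _ dE.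
have oC : ordered C by move=> c /(subsetP sCE) /oE.
have xC : noncrossing C by move=> c d /(subsetP sCE) cE /(subsetP sCE); exact: xE.
have aC := acyclic_sub oE aE sCE.
pose F beta := [set d in E :\: C | in_face C beta d].
have step beta : beta \in faces C -> #|beta|.-1 <= #|F beta| /\
    (#|F beta| <= #|beta|.-1 -> dissection (face_chords E C beta)).
  move=> bC; apply: (collapse_dissection (face_card bC)).
  - by move=> d; rewrite !inE => /andP[/andP[_ /oE]].
  - move=> c d; rewrite !inE => /andP[/andP[_ cE] _] /andP[/andP[_]] + _; exact: xE.
  move=> s t sb tb /same_faceP h; apply: (separated dE); apply/same_faceP => d dE'.
  have [dC|dC] := boolP (d \in C); first by have /same_faceP := face_same bC sb tb; apply.
  apply: contraTeq isT => ne.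
  suff dF : d \in F beta by rewrite (h _ dF) eqxx in ne.
  rewrite !inE dC dE'; apply/forall_inP => c cC; apply/forall_inP => r rb; apply/eqP.
  have /same_faceP /(_ c cC) -> := face_same bC rb sb.
  have /same_faceP /(_ c cC) := face_same bC sb tb.
  have := xC _ _ cC; have := oE _ dE'; have := oC _ cC.
  have := xE _ _ (subsetP sCE _ cC) dE'.
  by move: ne; rewrite /under /under_chord /crossing; lia.
have total : \sum_(beta in faces C) #|F beta| <= n - #|C|.
  have -> : n - #|C| = #|E :\: C| by rewrite cardsD (setIidPr sCE) kE.
  rewrite -sum1_card.
  under eq_bigr do rewrite -sum1_card big_mkcond /=.
  rewrite exchange_big /= [X in _ <= X]big_mkcond /=; apply: leq_sum => d _.
  have [dE'|dE'] := boolP (d \in E :\: C); last first.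
    by rewrite big1 // => beta _; rewrite inE (negPf dE').
  rewrite -big_mkcondr sum1_card; apply/card_le1_eqP => beta gamma.
  have inF delta : d \in F delta -> in_face C delta d by rewrite inE => /andP[].
  move=> /andP[bC /inF /forall_inP hb] /andP[gC /inF /forall_inP hg]; apply/esym.
  have [s sb] : exists s, s \in beta by apply/card_gt0P; rewrite (face_card bC).
  have [t tg] : exists t, t \in gamma by apply/card_gt0P; rewrite (face_card gC).
  apply: (face_uniq bC gC sb tg); apply/same_faceP => c cC.
  have /forall_inP /(_ s sb) /eqP <- := hb c cC.
  by have /forall_inP /(_ t tg) /eqP <- := hg c cC.
move=> aF; apply: (step _ aF).2.
have := sum_face_degrees oC xC aC; rewrite (bigD1 alpha) //=.
move: total; rewrite (bigD1 alpha) //=.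
set X := \sum_(_ in _ | _) _; set Y := \sum_(_ in _ | _) _.
have : Y <= X by apply: leq_sum => beta /andP[bC _]; apply: (step _ bC).1.
move: (X) (Y) => {}X {}Y; rewrite -/(F alpha).
move: #|F alpha| #|alpha|.-1 #|C| => a b k; clear; lia.
Qed.
End Closure.

Record diagram n := Diagram {
  chords :> {set chord n};
  chordsP : dissection chords
}.

HB.instance Definition _ n := [isSub for @chords n].
HB.instance Definition _ n := [Choice of diagram n by <:].
HB.instance Definition _ n := [Countable of diagram n by <:].
HB.instance Definition _ n := [Finite of diagram n by <:].

(* The nonempty dissection diagrams, of all degrees n.+1. *)
Definition ndiagram := {n : nat & diagram n.+1}.

Fact dissection_a : dissection [set ((ord0, ord_max) : chord 1)].
Proof.
apply: dissection_separated; rewrite ?cards1 //.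
- by move=> c /set1P ->.
- by move=> c d /set1P -> /set1P ->.
move=> s t /same_faceP /(_ _ (set11 _)); rewrite /under /= => st; apply: val_inj.
by move: s t st => [[|[|?]] ?] [[|[|?]] ?].
Qed.

Definition diagram_a : ndiagram := Tagged (fun m => diagram m.+1) (Diagram dissection_a : diagram 0.+1).

Section Coproduct.
Variables (K : fieldType) (x : K).

Section Parts.
Variables (n : nat) (D : diagram n).

Definition chord_subset := {C : {set chord n} | C \subset chords D}.
Definition face (C : {set chord n}) := {alpha : {set 'I_n.+1} | alpha \in faces C}.
Implicit Types C : chord_subset.

Definition diagram_of_face C (alpha : face (val C)) : diagram #|val alpha|.-1 :=
  Diagram (face_dissection (chordsP D) (valP C) (valP alpha)).

Definition residual C : diagram #|val C| :=
  Diagram (residual_dissection (chordsP D) (valP C)).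

(* The number of chords of C whose orientation is reversed in the residual
   diagram. *)
Definition reversals C : nat :=
  let f := collapse #|val C| (minimal_sides (val C)) in
  #|[set c in val C |
      arrow D c.1 c.2 && arrow (residual C) (f c.2) (f c.1)
      || arrow D c.2 c.1 && arrow (residual C) (f c.1) (f c.2)]|.

End Parts.

(* The polynomial algebra on ndiagram is {malg K[{cmonom ndiagram}]}. *)
Notation mon := {cmonom ndiagram}.

(* The generator associated with a diagram, or 1 for the diagram of degree 0. *)
Definition mon_of n : diagram n -> mon :=
  match n with
  | 0 => fun _ => mone
  | m.+1 => fun D => ucm (Tagged (fun m => diagram m.+1) D)
  end.

Definition quotient n (D : diagram n) (C : chord_subset D) : mon :=
  \big[mmul/mone]_(alpha : face (val C)) mon_of (diagram_of_face alpha).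

(* The tensor square of this algebra is represented by the free module on the
   pairs of monomials, (m1, m2) standing for the tensor product of m1 and m2. *)
Definition Delta n (D : diagram n) : {malg K[(mon * mon)%type]} :=
  (\sum_(C : chord_subset D)
     << x ^+ reversals C *g (quotient C, mon_of (residual C)) >>)%R.

(* The coefficient of D1 (x) D2 in Delta(G). *)
Definition coefD (D1 D2 G : ndiagram) : K := (Delta (tagged G))@_(ucm D1, ucm D2).

(* Delta being graded, coefD D diagram_a G vanishes unless the degree of G is one
   more than that of D (see coefD_degree and mcoeff_L), so that the sum over all G
   is finite. *)
Definition L (D : ndiagram) : {malg K[ndiagram]} :=
  (\sum_(G : diagram (tag D).+2)
     let G' := Tagged (fun m => diagram m.+1) G in
     << coefD D diagram_a G' *g G' >>)%R.

Lemma mon_of_degree n (D : diagram n) (E : ndiagram) :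
  mon_of D E != 0 -> n = (tag E).+1.
Proof.
case: n D => [|n] D; first by rewrite /mon_of cm1.
by rewrite /mon_of cmU; have [<-|] := eqVneq (Tagged (fun m => diagram m.+1) D) E.
Qed.

Lemma mon_of_gt0 n (D : diagram n) : 0 < n -> exists E : ndiagram, mon_of D E != 0.
Proof.
case: n D => // n D _; exists (Tagged (fun m => diagram m.+1) D).
by rewrite /mon_of cmUU.
Qed.

Lemma coefD_degree D G : coefD D diagram_a G != 0%R -> tag G = (tag D).+1.
Proof.
case: G => n G; rewrite /coefD /Delta /= raddf_sum /= => nz.
have /existsP[C /eqP] : [exists C : chord_subset G,
    (quotient C, mon_of (residual C)) == (ucm D, ucm diagram_a)].
  apply: contraNT nz; rewrite negb_exists => /forallP no.
  by apply/eqP/big1 => C _; rewrite mcoeffU (negPf (no C)).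
case=> qD ra.
have C1 : #|val C| = 1.
  by apply: (@mon_of_degree _ (residual C) diagram_a); rewrite ra cmUU.
have quotE E : \sum_(alpha : face (val C)) mon_of (diagram_of_face alpha) E = (D == E).
  rewrite -cmU -qD /quotient.
  by rewrite (big_morph (fun m : mon => m E) (cmM E) (cm1 E)).
have [alpha aD] : exists alpha : face (val C), mon_of (diagram_of_face alpha) D != 0.
  apply/existsP; apply: contraT; rewrite negb_exists => /forallP z.
  by have := quotE D; rewrite eqxx big1 // => alpha _; have := z alpha; rewrite negbK => /eqP.
have rest beta : beta != alpha -> #|val beta|.-1 = 0.
  move=> ne; apply/eqP; rewrite -leqn0 leqNgt; apply/negP => /(mon_of_gt0 (diagram_of_face beta)).
  move=> [E]; have := quotE E; rewrite (bigD1 beta) //= (bigD1 alpha) 1?[alpha == _]eq_sym //=.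
  case: (mon_of (diagram_of_face beta) E) => // b.
  case: (D =P E) aD => [->|_] //; case: (mon_of (diagram_of_face alpha) E) => // a _.
  by rewrite !addSn addnS.
have [oG xG aG _] := dissectionP _ (chordsP G).
have sCG := subsetP (valP C).
have := @sum_face_degrees _ (val C) _ _ (acyclic_sub oG aG (valP C)).
rewrite C1 big_sub (bigD1 alpha) //= big1 ?addn0; last exact: rest.
rewrite (mon_of_degree aD) => h; apply/esym/succn_inj; rewrite -h //.
  by move=> c /sCG /oG.
by move=> c d /sCG cG /sCG; apply: xG.
Qed.

Lemma mcoeff_L D G : (L D)@_G = coefD D diagram_a G.
Proof.
rewrite /L raddf_sum /=.
have [e|ne] := eqVneq (tag G) (tag D).+1; last first.
  rewrite big1 => [|G' _]; first by apply/esym/eqP; apply: contraNT ne => /coefD_degree ->.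
  by rewrite mcoeffU; case: eqP => // e; rewrite -e eqxx in ne.
case: G e => m G /= e; case: _ / e G => G.
rewrite (bigD1 G) //= mcoeffUU big1 ?addr0 // => G' ne.
by rewrite mcoeffU -tag_eqE /tag_eq /= eqxx tagged_asE (negPf ne).
Qed.

End Coproduct.

(* Main.v *)
Require Import Defs.
From mathcomp Require Import all_boot all_algebra.
From mathcomp Require Import zify finmap.
From mathcomp.multinomials Require Import monalg.

Set Implicit Arguments.
Unset Strict Implicit.
Unset Printing Implicit Defensive.

Import GRing.Theory.

(** A term D (x) a of the coproduct of G comes from a set C of chords reduced to
    one chord c that cuts off a single side i of the polygon of G, the other
    face giving D. So G is obtained from D by splitting a vertex into the two
    ends of side i and of c; the term has weight 1 or x. Since x is arbitrary
    (for instance -1), such terms may cancel, and L(D) has to be tested on a G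
    for which they cannot.

    The test diagrams are found by counting the chords at the root. Contracting
    c loses at most one of them (root_degree_contract). It loses one only if c
    itself is at the root and its other end is a leaf, so that i is the first
    or the last side: then G is D with a new leaf attached to the root, at vertex
    1 (the chords of D away from the root are shifted by one) or at the last
    vertex (the chords of D are unchanged). A chord at the root keeps its
    orientation, hence these terms have weight 1 (reversals_root). Let D' be the
    diagram D with a leaf added at the last vertex. Its coefficient in L(D) is
    then a positive integer, nonzero in characteristic 0 (coefD_append).

    Suppose that L(D1) = L(D2). Then D2' occurs in L(D1) and D1' in L(D2). The
    first fact shows that D1 has at least as many chords at the root as D2, the
    second the converse, so both are cases of equality (append_support). If the
    leaf that D2' loses to become D1 is the last vertex, the chords of D1 are
    among those of D2, and D1 = D2; similarly for D1'. Otherwise both lost leaves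
    are at vertex 1: the chords of D1 away from the root, shifted by one, are
    chords of D2, and conversely. As the polygon is finite there are no such
    chords (shift_star), and D1 and D2 both consist of all the chords from the
    root (diagram_star). *)

(** * Chords as pairs of natural numbers *)

(** Reading chords in nat allows the comparison of diagrams whose degrees are
    equal without being convertible, as when a face of degree #|alpha|.-1 is
    known to be a given diagram. *)
Definition edge n (E : {set chord n}) (u v : nat) : bool :=
  [exists c in E, (c.1 == u :> nat) && (c.2 == v :> nat)].

Definition root_degree n (E : {set chord n}) : nat :=
  #|[set c in E | c.1 == ord0]|.

Lemma card_chords n (D : diagram n) : #|chords D| = n.
Proof. by case/dissectionP: (chordsP D). Qed.

(** The two ways in which E can sit in E with a leaf added at the root: the leaf
    is the last vertex, or it is vertex 1 and pushes the other vertices. *)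
Definition kept_or_shifted m n (E : {set chord m}) (F : {set chord n}) : Prop :=
  (forall u v, edge E u v -> edge F u v) \/
  (forall u v, 0 < u -> edge E u v -> edge F u.+1 v.+1).

Section Edges.
Context {n : nat}.
Implicit Types (E : {set chord n}) (c d : chord n).

Lemma edgeP E (i j : nat) :
  reflect (exists2 c, c \in E & c.1 = i :> nat /\ c.2 = j :> nat) (edge E i j).
Proof.
apply: (iffP exists_inP) => -[c cE]; first by case/andP => /eqP ? /eqP ?; exists c.
by case=> <- <-; exists c => //; rewrite !eqxx.
Qed.

Lemma edge_mem E c : edge E c.1 c.2 = (c \in E).
Proof.
apply/edgeP/idP => [[[u v] dE /= [e1 e2]]|cE]; last by exists c.
by rewrite (surjective_pairing c) -(val_inj e1) -(val_inj e2).
Qed.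

Lemma chord_neq c d : d != c -> ~ (d.1 = c.1 :> nat /\ d.2 = c.2 :> nat).
Proof.
move=> dc [e1 e2]; case/eqP: dc.
by rewrite (surjective_pairing d) (surjective_pairing c) (val_inj e1) (val_inj e2).
Qed.

Lemma edge_le E (i j : nat) : edge E i j -> j <= n.
Proof. by case/edgeP => c _ [_ <-]; rewrite -ltnS. Qed.

End Edges.

(** * Contracting a chord parallel to a side *)

Section Contraction.
Context {n : nat}.
Implicit Types (E : {set chord n}) (c : chord n) (u v : 'I_n.+1).

Lemma collapse0 m (S : {set 'I_n.+1}) : collapse m S ord0 = ord0.
Proof.
apply: val_inj; rewrite /collapse /= (_ : [set _ in S | _] = set0).
  by rewrite cards0 mod0n inordK.
by apply/setP => s; rewrite !inE andbF.
Qed.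

Lemma card_before v : #|[set s : 'I_n.+1 | s < v]| = v.
Proof.
rewrite cardsE -sum1_card (big_ord_narrow (F := fun=> 1) (ltnW (ltn_ord v))).
by rewrite sum1_card card_ord.
Qed.

(** The vertex that wraps around to the root is the last one, n, and only when
    the side n joining it to the root is the contracted side. *)
Lemma collapse_but_one m (i v : 'I_n.+1) : n = m.+1 ->
  collapse m [set~ i] v =
    (if (i == n :> nat) && (v == n :> nat) then 0 else v - (i < v)) :> nat.
Proof.
move=> nm; rewrite collapseE; last by rewrite cardsC1 card_ord.
have -> : [set s in [set~ i] | s < v] = [set s : 'I_n.+1 | s < v] :\ i.
  by apply/setP => s; rewrite !inE.
have := cardsD1 i [set s : 'I_n.+1 | s < v]; rewrite card_before inE.
move: #|_ :\ i| (ltn_ord v) (ltn_ord i) nm => r; clear.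
by case: eqP => ?; case: ifP; lia.
Qed.

(** Such a chord cuts off the side i alone, as it joins the two ends of this
    side. The second case is the side n, whose ends are n and the root. *)
Definition parallel (c : chord n) (i : 'I_n.+1) : bool :=
  (c.1 == i :> nat) && (c.2 == i.+1 :> nat)
  || [&& c.1 == 0 :> nat, c.2 == n :> nat & i == n :> nat].

(** The cardinality hypothesis makes the contraction injective on chords. The
    chords at the root other than c remain at the root, which gives the bound.
    In the equality case c is at the root, and no further chord arrives there:
    the other end of c, which is merged with the root, is a leaf. It is
    vertex 1 or vertex n according to the contracted side. *)
Lemma root_degree_contract m E c (i : 'I_n.+1) : n = m.+1 -> ordered E ->
    c \in E -> parallel c i ->
    let F := [set collapse_chord m [set~ i] d | d in E :\ c] in
    #|F| = #|E :\ c| ->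
  root_degree E <= (root_degree F).+1 /\
  (root_degree E = (root_degree F).+1 ->
     c.1 = ord0 /\ kept_or_shifted F E).
Proof.
move=> nm oE cE ci F cF.
set kappa := collapse_chord m [set~ i] in F cF *.
pose T := [set d in E :\ c | (kappa d).1 == ord0].
have inj : {in E :\ c &, injective kappa} by apply/imset_injP/eqP.
have -> : root_degree F = #|T|.
  rewrite -(card_in_imset (f := kappa)); last first.
    by move=> d e; rewrite inE => /andP[dE _]; rewrite inE => /andP[eE _]; apply: inj.
  apply: eq_card => d; rewrite inE; apply/andP/imsetP => [[/imsetP[e eE ->] e0]|[e]].
    by exists e; rewrite // inE eE.
  by rewrite inE => /andP[eE e0] ->; rewrite imset_f.
pose R := [set d in E | d.1 == ord0].
have sRT : R :\ c \subset T.
  apply/subsetP => d; rewrite !inE => /andP[dc /andP[dE /eqP d0]].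
  rewrite dc dE /= /kappa /collapse_chord d0 collapse0.
  by case: ifP => //= /negbT; rewrite -leqNgt leqn0.
have RT := subset_leq_card sRT.
rewrite /root_degree -/R (cardsD1 c R); split.
  exact: leq_add (leq_b1 _) RT.
have [cR|_] := boolP (c \in R); last by rewrite add0n => e; rewrite e ltnn in RT.
rewrite add1n => -[RT']; have {}RT : R :\ c = T.
  by apply/eqP; rewrite eqEcard sRT RT' leqnn.
have c0 : c.1 = ord0 by apply/eqP; move: cR; rewrite inE => /andP[].
split=> //.
have val_kappa d := collapse_but_one i (d : 'I_n.+1) nm.
(* no chord other than those already at the root is brought there *)
have Tr d : d \in E -> d != c -> collapse m [set~ i] d.1 = 0 :> nat
   \/ collapse m [set~ i] d.2 = 0 :> nat -> d.1 = 0 :> nat.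
  move=> dE dc h; have : d \in T.
    rewrite !inE dc dE /= /kappa /collapse_chord -val_eqE.
    by move: h; move: (collapse _ _ _) (collapse _ _ _) => a b; clear; case: ifP => /=; lia.
  by rewrite -RT !inE dc dE => /eqP ->.
(* hence the contraction does not exchange the two ends of a chord *)
have key d : d \in E -> d != c ->
   collapse m [set~ i] d.1 < collapse m [set~ i] d.2.
  move=> dE dc; have := Tr _ dE dc; rewrite !val_kappa.
  have := chord_neq dc; have := oE _ dE; have := oE _ cE; have := ltn_ord d.2.
  move: ci; rewrite /parallel c0 /=; clear; move: (c.2) (d.1) (d.2) => a b e.
  by case: ifP; case: ifP; lia.
have Fedge (u v : nat) : edge F u v -> exists2 d, d \in E & [/\ d != c,
    collapse m [set~ i] d.1 = u :> nat & collapse m [set~ i] d.2 = v :> nat].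
  case/edgeP => _ /imsetP[d /setD1P[dc dE] ->]; rewrite /kappa /collapse_chord key //=.
  by case=> <- <-; exists d.
have [i0|iN] : i = 0 :> nat \/ i = n :> nat.
  by move: ci; rewrite /parallel c0 /=; lia.
- right=> u v u0 /Fedge[d dE [dc du dv]]; apply/edgeP; exists d => //.
  move: du dv (oE _ dE); rewrite !val_kappa i0.
  by have -> : (0 == n) = false; [rewrite nm|rewrite /=; clear - u0; lia].
left=> u v /Fedge[d dE [dc du dv]]; apply/edgeP; exists d => //.
have := Tr _ dE dc; have := key _ dE dc; have := chord_neq dc; move: du dv (oE _ dE) ci.
have := ltn_ord d.1; have := ltn_ord d.2.
rewrite /parallel c0 !val_kappa iN eqxx; clear - nm; case: ifP; case: ifP; lia.
Qed.

End Contraction.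

(** * Orientation of the chords at the root *)

(** Removing a chord at the root disconnects its other end from the root. *)
Lemma arrow_from_root n (E : {set chord n}) u : dissection E -> arrow E ord0 u = false.
Proof.
case/dissectionP => oE _ aE _; apply/negbTE/negP => /andP[/orP[cE|/oE //] con].
have := acyclic_bridge oE aE cE; rewrite connect_adj_sym => /negP; apply.
apply: connect_sub con => v w; rewrite /adj !inE !negb_or => h; apply: connect1.
by move: h; rewrite /adj !inE => /orP[]/andP[/andP[-> _] ->]; rewrite ?orbT.
Qed.

(** The root is sent to the root, and a chord at the root points to the root
    both before and after the contraction. *)
Lemma reversals_root n (D : diagram n) (C : chord_subset D) :
  {in val C, forall c, c.1 = ord0} -> reversals C = 0.
Proof.
move=> rC; apply/eqP; rewrite cards_eq0; apply/eqP/setP => c; rewrite !inE.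
case: (boolP (c \in val C)) => //= /rC ->; rewrite collapse0.
have res (u : 'I__) : arrow (residual C) ord0 u = false by apply/arrow_from_root/chordsP.
by rewrite res (arrow_from_root _ (chordsP D)) !andbF.
Qed.

(** * Faces cut off by a chord parallel to a side *)

Section Faces.
Context {n : nat}.
Implicit Types (c d : chord n) (i s : 'I_n.+1).

Lemma face_but_one c alpha : c.1 < c.2 -> alpha \in faces [set c] -> #|alpha| = n ->
  exists2 i, alpha = [set~ i] & parallel c i.
Proof.
move=> oc fa ca; have [r er] := facesP _ _ fa.
have /eqP/cards1P[i ei] : #|~: alpha| = 1.
  by have := cardsC alpha; rewrite card_ord ca; move: #|~: alpha|; lia.
have {}er s : (under c s == under c r) = (s != i).
  have := in_setC s alpha; rewrite ei inE er inE => ->; rewrite negbK.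
  apply/eqP/same_faceP => [e d /set1P -> //|h]; by rewrite h ?set11.
exists i; first by rewrite -ei setCK.
have n0 : 0 < n by rewrite -ca (face_card fa).
(* side n is never under c, so it tells which part of the polygon alpha is *)
have := er ord_max; rewrite under_last; have [iN|iN] := eqVneq ord_max i => z.
  subst i.
  have {z er}uc s : under c s = (s != ord_max).
    by move: z; rewrite -er; case: (under c r); case: (under c s).
  have /andP[c1 _] : under c ord0 by rewrite uc -val_eqE /= eq_sym -lt0n.
  have nK : (inord n.-1 : 'I_n.+1) = n.-1 :> nat by rewrite inordK // ltnS leq_pred.
  have /andP[_] : under c (inord n.-1) by rewrite uc -val_eqE /= nK ltn_eqF ?prednK.
  rewrite nK prednK // => c2.
  by rewrite /parallel [c.2 == n :> nat]eqn_leq c2 -ltnS ltn_ord -leqn0 c1 /= eqxx orbT.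
have {z er}uc s : under c s = (s == i).
  by apply: negb_inj; move: z; rewrite -er; case: (under c r); case: (under c s).
have /eqP e1 : c.1 == i by rewrite -uc /under leqnn.
have c2K : (inord c.2.-1 : 'I_n.+1) = c.2.-1 :> nat.
  by rewrite inordK // (leq_ltn_trans (leq_pred _)).
have c2 : 0 < c.2 := leq_ltn_trans (leq0n _) oc.
have /eqP e2 : inord c.2.-1 == i.
  by rewrite -uc /under c2K prednK // leqnn andbT -ltnS prednK.
by rewrite /parallel e1 -e2 c2K prednK // !eqxx.
Qed.

Lemma face_chords_but_one E c i : ordered E -> c \in E -> parallel c i ->
  face_chords E [set c] [set~ i] =
    [set collapse_chord #|[set~ i]|.-1 [set~ i] d | d in E :\ c].
Proof.
move=> oE cE ci; rewrite /face_chords.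
suff -> : [set d in E :\: [set c] | in_face [set c] [set~ i] d] = E :\ c by [].
apply/setP => d; rewrite inE; have [dE|//] := boolP (d \in E :\ c).
apply/forall_inP => _ /set1P ->; apply/forall_inP => s; rewrite !inE => si.
move: dE; rewrite !inE => /andP[dc /oE od].
move: ci si od (chord_neq dc) (oE _ cE) (ltn_ord d.2) (ltn_ord s); clear.
by rewrite /parallel /under_chord /under -val_eqE /=; lia.
Qed.

End Faces.

(** Stated for a predicate on diagrams of all degrees, since n and (tag D).+1
    are equal but not convertible. *)
Lemma mon_of_transport n (E : diagram n) (D : ndiagram) (P : forall k, diagram k -> Prop) :
  mon_of E D != 0 -> P n E -> P (tag D).+1 (tagged D).
Proof.
case: n E => [|n] E; first by rewrite /mon_of cm1.
by rewrite /mon_of cmU; case: (_ =P D) => // <-.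
Qed.

Lemma mon_of_generator n (E : diagram n) (D : ndiagram) :
  n = (tag D).+1 -> edge E =2 edge (tagged D) -> mon_of E = ucm D.
Proof.
case: n E => [|n] E; first by move=> e; discriminate e.
case=> e; case: D e => k D /= e; case: _ / e D => D ED.
congr (ucm (Tagged _ _)); apply/val_inj/setP => c.
by rewrite -!edge_mem ED.
Qed.

(** The bound of root_degree_contract for a term of the coproduct of G equal to
    D (x) a up to a scalar. The residual diagram has degree 1, so C is a single
    chord; D is one of the two faces and has all the sides but one, so this chord
    is parallel to a side. *)
Lemma root_degree_quotient (D G : ndiagram) (C : chord_subset (tagged G)) :
    tag G = (tag D).+1 -> quotient C = ucm D -> mon_of (residual C) = ucm diagram_a ->
  let r E := root_degree (chords (tagged E)) in
  r G <= (r D).+1 /\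
  (r G = (r D).+1 ->
     {in val C, forall c, c.1 = ord0} /\ kept_or_shifted (tagged D) (tagged G)).
Proof.
case: G C => m G C /= em qC rC; have [oG _ _ kG] := dissectionP _ (chordsP G).
have C1 : #|val C| = 1.
  by apply: (@mon_of_degree _ (residual C) diagram_a); rewrite rC cmUU.
have [alpha aD] : exists alpha : face (val C), mon_of (diagram_of_face alpha) D != 0.
  apply/existsP; apply: contraT; rewrite negb_exists => /forallP z.
  have := cmUU D; rewrite -qC /quotient.
  rewrite (big_morph (fun m : {cmonom ndiagram} => m D) (cmM D) (cm1 D)).
  by rewrite big1 // => alpha _; have := z alpha; rewrite negbK => /eqP.
have ca : #|val alpha| = m.+1.
  by rewrite (face_card (valP alpha)) (mon_of_degree aD) em.
have [c eC] : exists c, val C = [set c] by apply/cards1P/eqP.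
have cG : c \in chords G by apply: (subsetP (valP C)); rewrite eC set11.
have fa : val alpha \in faces [set c] by rewrite -eC; exact: (valP alpha).
have [i ai ci] := face_but_one (oG _ cG) fa ca.
pose P k (E : {set chord k}) := root_degree G <= (root_degree E).+1 /\
  (root_degree G = (root_degree E).+1 ->
     {in val C, forall c, c.1 = ord0} /\ kept_or_shifted E G).
(* alpha has a type depending on C: the substitutions are made in a statement
   about arbitrary sets *)
apply: (mon_of_transport (P := fun k E => P k (chords E)) aD).
have key C0 beta : C0 = [set c] -> beta = [set~ i] -> #|beta| = m.+1 ->
    #|face_chords G C0 beta| = #|beta|.-1 -> P _ (face_chords G C0 beta).
  move=> -> -> cb; rewrite /P (face_chords_but_one oG cG ci) => kF.
  have [||h1 h2] := root_degree_contract _ oG cG ci (etrans kF _).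
  - by rewrite cb.
  - by have := cardsD1 c G; rewrite kG cG cb => -[].
  split=> // /h2[c0 h]; split; last exact: h.
  by move=> d; rewrite eC => /set1P ->.
exact: key eC ai ca (card_chords (diagram_of_face alpha)).
Qed.

(** * Adding a leaf at the last vertex *)

Section Append.
Context {n : nat}.
Variable D : diagram n.

Definition widen_chord (c : chord n) : chord n.+1 :=
  (widen_ord (leqnSn n.+1) c.1, widen_ord (leqnSn n.+1) c.2).

Definition append_chords : {set chord n.+1} :=
  (ord0, ord_max) |: [set widen_chord c | c in chords D].

Lemma append_dissection : dissection append_chords.
Proof.
have [oD xD _ kD] := dissectionP _ (chordsP D).
apply: dissection_separated.
- by move=> c /setU1P[->//|/imsetP[d /oD ? ->]].
- move=> c d /setU1P[->|/imsetP[c' cD ->]] /setU1P[->|/imsetP[d' dD ->]].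
  + by [].
  + by rewrite /crossing /= orbF negb_and -!leqNgt (ltnW (ltn_ord d'.2)) orbT.
  + by rewrite /crossing /= negb_and -!leqNgt (ltnW (ltn_ord c'.2)) orbT.
  + exact: xD cD dD.
- apply: leq_trans (leq_card_setU _ _) _; rewrite cards1 ltnS -[X in _ <= X]kD.
  exact: leq_imset_card.
(* the new chord isolates the last side, the chords of D separate the others *)
move=> s t /same_faceP h; apply: val_inj => /=.
have := h _ (setU11 _ _); rewrite /under /=.
have [sn|sn] := ltnP s n.+1; have [tn|tn] := ltnP t n.+1 => //; last first.
  by have := ltn_ord s; have := ltn_ord t; lia.
move=> _; suff /(congr1 val) : Ordinal sn = Ordinal tn by [].
apply: (separated (chordsP D)); apply/same_faceP => c cD.
by apply: (h (widen_chord c)); rewrite !inE imset_f ?orbT.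
Qed.

Definition append : diagram n.+1 := Diagram append_dissection.

Lemma edge_append u v : edge append u v = edge D u v || (u == 0) && (v == n.+1).
Proof.
apply/edgeP/orP => [[c /setU1P[->|/imsetP[d dD ->]] [/= <- <-]]|[/edgeP[c cD [<- <-]]|]].
- by right; rewrite !eqxx.
- by left; apply/edgeP; exists d.
- by exists (widen_chord c); rewrite // !inE imset_f ?orbT.
case/andP=> /eqP -> /eqP ->; exists (ord0, ord_max); by rewrite ?setU11.
Qed.

Lemma root_degree_append : root_degree append = (root_degree D).+1.
Proof.
have inj : injective widen_chord.
  by move=> [a b] [c d] [/val_inj -> /val_inj ->].
rewrite /root_degree -(card_imset _ inj).
rewrite (_ : [set c in append | _] =
  (ord0, ord_max) |: widen_chord @: [set c in D | c.1 == ord0]).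
  rewrite cardsU1; case: imsetP => [[c _ /(congr1 snd) /(congr1 val) /= e]|_] //.
  by have := ltn_ord c.2; rewrite -e ltnn.
apply/setP => c; rewrite !inE; apply/andP/orP.
  case=> /orP[->|/imsetP[d dD ->] h]; first by left.
  by right; rewrite imset_f // inE dD -val_eqE.
case=> [/eqP ->|/imsetP[d]]; first by rewrite eqxx.
by rewrite inE => /andP[dD d0] ->; rewrite imset_f ?orbT //= -val_eqE.
Qed.

Lemma append_chord_parallel : parallel ((ord0, ord_max) : chord n.+1) ord_max.
Proof. by rewrite /parallel /= !eqxx. Qed.

Lemma edge_face_append :
  edge (face_chords append [set (ord0, ord_max)] [set~ ord_max]) =2 edge D.
Proof.
have [oA _ _ _] := dissectionP _ append_dissection.
rewrite (face_chords_but_one oA (setU11 _ _) append_chord_parallel).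
have cT : n.+1 = #|[set~ (ord_max : 'I_n.+2)]|.-1.+1 by rewrite cardsC1 card_ord.
have val_collapse (v : 'I_n.+1) :
    collapse #|[set~ (ord_max : 'I_n.+2)]|.-1 [set~ ord_max] (widen_ord (leqnSn n.+1) v)
      = v :> nat.
  by rewrite (collapse_but_one _ _ cT) /=; have := ltn_ord v; case: ifP; lia.
have [oD _ _ _] := dissectionP _ (chordsP D).
have val_chord c : c \in chords D ->
    let c' := collapse_chord #|[set~ (ord_max : 'I_n.+2)]|.-1 [set~ ord_max] (widen_chord c) in
    c'.1 = c.1 :> nat /\ c'.2 = c.2 :> nat.
  by move=> /oD cD; rewrite /collapse_chord !val_collapse cD /= !val_collapse.
move=> u v; apply/edgeP/edgeP.
  case=> _ /imsetP[d /setD1P[ne /setU1P[e|/imsetP[c cD ->]]] ->] [<- <-].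
    by rewrite e eqxx in ne.
  by have [e1 e2] := val_chord _ cD; exists c.
case=> c cD [<- <-].
exists (collapse_chord #|[set~ (ord_max : 'I_n.+2)]|.-1 [set~ ord_max] (widen_chord c)).
  apply: imset_f; rewrite !inE imset_f // orbT andbT xpair_eqE negb_and; apply/orP; right.
  by rewrite -val_eqE /= ltn_eqF.
exact: val_chord.
Qed.

End Append.

Lemma mon_of_degree0 n (E : diagram n) : n = 0 -> mon_of E = mone.
Proof. by case: n E. Qed.

Lemma mon_of_degree1 n (E : diagram n) : n = 1 -> mon_of E = ucm diagram_a.
Proof.
case: n E => [|n] E n1; first discriminate n1.
case: n1 E => n0; case: _ / (esym n0) => E.
congr (ucm (Tagged _ _)); apply: val_inj; apply/eqP.
have [oE _ _ kE] := dissectionP _ (chordsP E).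
rewrite eqEcard cards1 kE leqnn andbT; apply/subsetP => -[u v] /oE uv.
rewrite inE xpair_eqE -!val_eqE /=; move: uv (ltn_ord v) => /=; lia.
Qed.

(** Of the two faces cut by the new chord, the one with a single side contributes
    the factor 1 and the other one is D. *)
Lemma append_contraction n (D : diagram n.+1) :
  exists C : chord_subset (append D), quotient C = ucm (Tagged (fun m => diagram m.+1) D) /\
    mon_of (residual C) = ucm diagram_a.
Proof.
pose c : chord n.+2 := (ord0, ord_max).
have cA : [set c] \subset chords (append D) by rewrite sub1set setU11.
pose C : chord_subset (append D) := exist _ [set c] cA.
have fa : [set~ ord_max] \in faces [set c].
  apply/facesP; exists ord0; apply/setP => t; rewrite !inE.
  apply/idP/same_faceP => [tm _ /set1P ->|/(_ _ (set11 _))].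
    by move: tm; rewrite /under -val_eqE /=; have := ltn_ord t; lia.
  by rewrite /under -val_eqE /=; have := ltn_ord t; lia.
exists C; split; last by apply: mon_of_degree1; exact: cards1.
pose alpha : face (val C) := exist (fun beta => beta \in faces [set c]) _ fa.
rewrite /quotient (bigD1 alpha) //= big1 => [|beta ne].
  rewrite mulm1; apply: mon_of_generator; first by rewrite /= cardsC1 card_ord.
  exact: edge_face_append.
(* another face has no side in common with alpha, so at most the last side *)
apply: mon_of_degree0; apply/eqP; rewrite -leqn0 -subn1 leq_subLR addn0.
rewrite -(cards1 (ord_max : 'I_n.+3)); apply/subset_leq_card/subsetP => s sb; rewrite inE.
apply: contraNT ne => sm; apply/eqP/val_inj.
by apply: (face_uniq (valP beta) fa sb) (same_face_refl _ s); rewrite !inE.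
Qed.

(** * Coefficients of L *)

Section Coefficients.
Variables (K : fieldType) (x : K).

Local Notation contracts C D :=
  ((quotient C == ucm D) && (mon_of (residual C) == ucm diagram_a)).

Lemma coefD_sum D G :
  (Defs.coefD x D diagram_a G =
    \sum_(C : chord_subset (tagged G) | contracts C D) x ^+ reversals C)%R.
Proof.
rewrite /Defs.coefD /Delta raddf_sum /= [RHS]big_mkcond; apply: eq_bigr => C _.
by rewrite mcoeffU xpair_eqE; case: ifP => _; rewrite ?mulr1n ?mulr0n.
Qed.

Lemma coefD_neq0 D G : (Defs.coefD x D diagram_a G != 0)%R ->
  tag G = (tag D).+1 /\ exists C : chord_subset (tagged G),
    quotient C = ucm D /\ mon_of (residual C) = ucm diagram_a.
Proof.
move=> nz; split; first exact: coefD_degree nz.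
have /existsP[C /andP[/eqP q /eqP r]] : [exists C : chord_subset (tagged G), contracts C D].
  apply: contraNT nz; rewrite negb_exists coefD_sum => /forallP no.
  by rewrite big_pred0 // => C; apply/negbTE.
by exists C.
Qed.

Definition nappend (D : ndiagram) : ndiagram :=
  Tagged (fun m => diagram m.+1) (append (tagged D)).

(** Adding the leaf raises the number of chords at the root, so that every
    contraction back to D is a case of equality in root_degree_quotient and has
    weight 1. The coefficient is thus the number of these contractions. *)
Lemma coefD_append (charK : [pchar K]%R =i pred0) D :
  (Defs.coefD x D diagram_a (nappend D) != 0)%R.
Proof.
rewrite coefD_sum.
rewrite (eq_bigr (fun=> 1%R)) => [|C /andP[/eqP q /eqP r]]; last first.
  have [_ h] := @root_degree_quotient D (nappend D) C erefl q r.
  by have [rC _] := h (root_degree_append _); rewrite reversals_root.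
rewrite GRing.sumr_const; have /pcharf0P -> := charK.
rewrite -lt0n; case: D => n D; have [C [q r]] := append_contraction D.
by apply/card_gt0P; exists C; rewrite unfold_in /= q r !eqxx.
Qed.

(** The bound on chords at the root, read on the diagram E before its leaf was
    added: neither an unshifted chord of D, which does not reach the last vertex,
    nor a shifted one, which is away from the root, is the chord of this leaf. *)
Lemma append_support (D E : ndiagram) :
    (Defs.coefD x D diagram_a (nappend E) != 0)%R ->
  [/\ tag D = tag E, root_degree (tagged E) <= root_degree (tagged D) &
    root_degree (tagged E) = root_degree (tagged D) ->
      kept_or_shifted (tagged D) (tagged E)].
Proof.
case/coefD_neq0 => eDE [C [q r]]; have [] := root_degree_quotient eDE q r.
rewrite /= root_degree_append ltnS => le_r h; have [eD] := eDE.
split=> // er; have [|_ {}h] := h _; first by rewrite er.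
case: h => h; [left=> u v e | right=> u v u0 e]; have := h u v; last first.
  by rewrite u0 e edge_append orbF => /(_ isT isT).
rewrite e edge_append => /(_ isT)/orP[//|/andP[_ /eqP ve]].
by have := edge_le e; rewrite ve -eD ltnn.
Qed.

End Coefficients.

(** * Comparing two diagrams of the same degree *)

(** Both diagrams have n chords. *)
Lemma diagram_sub_eq n (D E : diagram n) :
  (forall u v, edge D u v -> edge E u v) -> D = E.
Proof.
move=> sub; apply: val_inj; apply/eqP; rewrite eqEcard !card_chords leqnn andbT.
by apply/subsetP => c; rewrite -!edge_mem; apply: sub.
Qed.

(** There are n chords, as many as vertices other than the root. *)
Lemma diagram_star n (D : diagram n) : (forall u v, 0 < u -> ~~ edge D u v) ->
  chords D = [set (ord0, lift ord0 j) | j : 'I_n].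
Proof.
move=> star; have [oD _ _ _] := dissectionP _ (chordsP D).
apply/eqP; rewrite eqEcard card_chords -[X in _ <= X]card_ord leq_imset_card andbT.
apply/subsetP => c cD; have oc := oD _ cD.
have c1 : c.1 = ord0.
  apply: val_inj; have := star c.1 c.2; rewrite edge_mem cD /=.
  by case: (val c.1) => // k /(_ isT).
have [j ej|e] := unliftP ord0 c.2; last by rewrite e in oc.
by apply/imsetP; exists j; rewrite // -ej -c1 -surjective_pairing.
Qed.

(** A chord away from the root could be shifted forever, each time to larger
    vertices of the same polygon. *)
Lemma shift_star n (D E : diagram n) :
    (forall u v, 0 < u -> edge D u v -> edge E u.+1 v.+1) ->
    (forall u v, 0 < u -> edge E u v -> edge D u.+1 v.+1) ->
  forall u v, 0 < u -> ~~ edge D u v.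
Proof.
move=> DE ED u v u0.
have : n < v + n.+1 by rewrite addnS ltnS leq_addl.
(* induction on the room left after v; two shifts lead from D back to D *)
elim: {2}n.+1 u v u0 => [|k IH] u v u0 vk; apply/negP => e.
  by have := edge_le e; lia.
have := IH u.+2 v.+2 isT; rewrite ED ?DE //; apply/implyP; lia.
Qed.

Local Open Scope ring_scope.

Theorem proposition40 (K : fieldType) (charK : [pchar K] =i pred0) (x : K)
  (D1 D2 : ndiagram) :
  L x D1 = L x D2 <-> D1 = D2.
Proof.
split=> [eL|->//].
have nz E F : L x E = L x F -> Defs.coefD x E diagram_a (nappend F) != 0.
  by move=> eEF; rewrite -mcoeff_L eEF mcoeff_L coefD_append.
have [e12 r12 h12] := append_support (nz _ _ eL).
have [_ r21 h21] := append_support (nz _ _ (esym eL)).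
case: D1 D2 e12 r12 h12 r21 h21 {eL nz} => n D1 [m D2] /= e.
case: _ / e D2 => D2 r12 h12 r21 h21.
congr Tagged.
have er : root_degree D2 = root_degree D1 by apply/eqP; rewrite eqn_leq r12 r21.
have [/diagram_sub_eq //|DE] := h12 er.
have [/diagram_sub_eq ->//|ED] := h21 (esym er).
apply: val_inj => /=.
by rewrite (diagram_star (shift_star DE ED)) (diagram_star (shift_star ED DE)).
Qed.
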